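(* Let $n$ be an integer with $4\le n<\infty$, and let $A=\mathrm{IDD}(K^0_n,0,-2)$ be the complex algebra with basis $e_0,e_1,\ldots,e_n$ and bilinear multiplication $e_i\diamond e_j=\frac{1}{(j+1)(j+2)}e_{i+j+2}$ if $i+j\le n-2$, and $e_i\diamond e_j=0$ otherwise. Then the space of derivations of $A$ is $$\mathfrak{Der}(A)=\langle\varphi,\ \phi_i,\ \psi_j : 0\le i\le 3,\ 0\le j\le 1\rangle,$$ where these linear maps are given on the basis (all values not listed being zero) by - $\varphi(e_i)=(i+2)e_i$ for $0\le i\le n$; - $\phi_3(e_0)=(n-1)(n^2-4)e_{n-3}$, $\phi_3(e_1)=n^2(n-1)e_{n-2}$, $\phi_3(e_2)=(n+2)(n^2-3n+4)e_{n-1}$, $\phi_3(e_3)=(n+1)(n^2-2n+4)e_n$; - $\phi_2(e_0)=n(n-1)e_{n-2}$, $\phi_2(e_2)=(n^2-n+2)e_n$; - $\phi_1(e_0)=e_{n-1}$; - $\phi_0(e_0)=e_n$; - $\psi_1(e_1)=e_{n-1}$; - $\psi_0(e_1)=e_n$.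
   Context: A derivation of an algebra $(A,\diamond)$ is a linear map $D:A\to A$ with $D(a\diamond b)=D(a)\diamond b+a\diamond D(b)$ for all $a,b\in A$. $\langle S\rangle$ denotes the linear span of $S$ over $\mathbb C$. *)

(* Defs.v *)
From mathcomp Require Import all_boot all_order all_algebra.
From mathcomp Require Import complex.
From mathcomp Require Import reals.

Set Implicit Arguments.
Unset Strict Implicit.
Unset Printing Implicit Defensive.

Import GRing.Theory.
Local Open Scope ring_scope.

Definition is_derivation (K : fieldType) (V : vectType K) (mul : V -> V -> V)
    (D : 'End(V)) : Prop :=
  forall a b : V, D (mul a b) = mul (D a) b + mul a (D b).

Section IDD.
Variables (K : fieldType) (n : nat).

(* [inord] sends k > n to 0, so this is e_k only for k <= n; every use below
   stays in that range (for n >= 3). *)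
Definition e (k : nat) : 'rV[K]_n.+1 := delta_mx 0 (inord k).

(* the linear map with e_i |-> f i for 0 <= i <= n *)
Definition lin_ext (f : nat -> 'rV[K]_n.+1) : 'End('rV[K]_n.+1) :=
  linfun (mulmxr (\matrix_(i < n.+1) f i)).

(* [i + j + 2 <= n] is i + j <= n - 2, without truncated subtraction. *)
Definition idd_basis_mul (i j : nat) : 'rV[K]_n.+1 :=
  if (i + j + 2 <= n)%N then ((j + 1) * (j + 2))%:R^-1 *: e (i + j + 2) else 0.

Definition idd_mul (a b : 'rV[K]_n.+1) : 'rV[K]_n.+1 :=
  \sum_(i < n.+1) \sum_(j < n.+1) (a 0 i * b 0 j) *: idd_basis_mul i j.

Lemma lin_ext_basis (f : nat -> 'rV[K]_n.+1) (k : nat) :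
  (k <= n)%N -> lin_ext f (e k) = f k.
Proof. by move=> kn; rewrite lfunE /= /e -rowE rowK inordK. Qed.

Lemma idd_mul_basis (i j : nat) :
  (i <= n)%N -> (j <= n)%N -> idd_mul (e i) (e j) = idd_basis_mul i j.
Proof.
move=> ni nj; rewrite /idd_mul (bigD1 (inord i)) //= (bigD1 (inord j)) //=.
rewrite !mxE !eqxx mulr1 scale1r !inordK // !big1 ?addr0 // => k /negPf kP.
  by apply: big1 => l _; rewrite !mxE kP mul0r scale0r.
by rewrite !mxE kP mulr0 scale0r.
Qed.

Definition varphi : 'End('rV[K]_n.+1) :=
  lin_ext (fun i => (i%:R + 2) *: e i).

Definition phi3 : 'End('rV[K]_n.+1) :=
  lin_ext (fun i =>
    match i with
    | 0 => ((n%:R - 1) * (n%:R ^+ 2 - 4)) *: e (n - 3)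
    | 1 => (n%:R ^+ 2 * (n%:R - 1)) *: e (n - 2)
    | 2 => ((n%:R + 2) * (n%:R ^+ 2 - 3 * n%:R + 4)) *: e (n - 1)
    | 3 => ((n%:R + 1) * (n%:R ^+ 2 - 2 * n%:R + 4)) *: e n
    | _ => 0
    end).

Definition phi2 : 'End('rV[K]_n.+1) :=
  lin_ext (fun i =>
    match i with
    | 0 => (n%:R * (n%:R - 1)) *: e (n - 2)
    | 2 => (n%:R ^+ 2 - n%:R + 2) *: e n
    | _ => 0
    end).

Definition phi1 : 'End('rV[K]_n.+1) :=
  lin_ext (fun i => if i is 0 then e (n - 1) else 0).

Definition phi0 : 'End('rV[K]_n.+1) :=
  lin_ext (fun i => if i is 0 then e n else 0).

Definition psi1 : 'End('rV[K]_n.+1) :=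
  lin_ext (fun i => if i is 1 then e (n - 1) else 0).

Definition psi0 : 'End('rV[K]_n.+1) :=
  lin_ext (fun i => if i is 1 then e n else 0).

End IDD.

Arguments e : clear implicits.
Arguments idd_mul : clear implicits.
Arguments varphi : clear implicits.
Arguments phi3 : clear implicits.
Arguments phi2 : clear implicits.
Arguments phi1 : clear implicits.
Arguments phi0 : clear implicits.
Arguments psi1 : clear implicits.
Arguments psi0 : clear implicits.

(* Main.v *)
Require Import Defs.
From mathcomp Require Import all_boot all_order all_algebra.
From mathcomp Require Import complex.
From mathcomp Require Import reals.
From HB Require Import structures.
From mathcomp Require Import zify ring.
Import GRing.Theory Num.Theory.
Local Open Scope ring_scope.

(** Writing [e_i] for [x^i], the product is [a] times the double primitive of
    [b], truncated above degree [n].  The basis vectors [e_0] and [e_1]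
    generate the algebra, since [e_(k+2) = 2 (e_k e_0)]; so a derivation [D] is
    determined by the coefficients [a_k] of [D e_0] and [b_k] of [D e_1]
    ([derivation_eq0]), and the question is which of them may be prescribed.

    Two coincidences among products constrain them.  Both [e_0 e_1] and
    [e_1 e_0] are multiples of [e_3], which gives [b_0 = 0] and, for
    [k + 3 <= n], a linear relation between [a_k] and [b_(k+1)]
    ([derivation_relation_e3]); it is void for [k = 0] and determines
    [b_(k+1)] from [a_k] for [k > 0].  Both [e_1 e_1] and [e_2 e_0] are
    multiples of [e_4], which gives a second relation, for [k + 4 <= n]
    ([derivation_relation_e4]).  For [k = 0] it says [2 b_1 = 3 a_0]; for
    [0 < k <= n - 4] the two relations are independent and force
    [a_k = b_(k+1) = 0] ([derivation_e0_coef_middle]).  What survives is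
    [a_0], [a_(n-3)], [a_(n-2)], [a_(n-1)], [a_n], [b_(n-1)] and [b_n]: one free
    parameter for each of the seven listed maps.  Subtracting the combination
    of those maps with the same seven parameters leaves a derivation that
    kills [e_0] and [e_1], hence zero ([derivation_in_span]).

    Conversely each listed map is homogeneous of some degree [k], that is,
    [e_i] goes to [c_i e_(i+k)], and being a derivation is then a numerical
    identity on the [c_i], needed only where [i + j + 2 + k <= n]
    ([homogeneous_derivation]).  All listed degrees other than 0 are at least
    [n - 3], so at most three pairs [(i, j)] have to be examined. *)

(** * Derivations form a subspace *)

Section Derivations.
Variables (K : fieldType) (V : vectType K) (mul : {bilinear V -> V -> V}).

Lemma derivation0 : is_derivation mul 0.
Proof. by move=> a b; rewrite !lfunE /= linear0l linear0r addr0. Qed.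

Lemma derivation_linear (c : K) (D E : 'End(V)) :
  is_derivation mul D -> is_derivation mul E -> is_derivation mul (c *: D + E).
Proof.
move=> dD dE a b; rewrite !lfunE /= !lfunE /= dD dE linearDl linearDr.
by rewrite linearZl_LR linearZr_LR scalerDr addrACA.
Qed.

Lemma derivation_span (X : seq 'End(V)) (D : 'End(V)) :
  {in X, forall E, is_derivation mul E} -> D \in <<X>>%VS ->
  is_derivation mul D.
Proof.
move=> dX /(@coord_span _ _ _ (in_tuple X)) ->.
elim/big_ind: _ => [|E F dE dF|i _]; first exact: derivation0.
  by rewrite -[E]scale1r; apply: derivation_linear.
rewrite -[X in is_derivation _ X]addr0; apply: derivation_linear derivation0.
by apply/dX/mem_nth.
Qed.

End Derivations.

(** * The algebra in coordinates *)

Section Algebra.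
Variables (K : fieldType) (n : nat).
Local Notation V := 'rV[K]_n.+1.
Local Notation e := (e K n).
Local Notation "a <o> b" := (idd_mul K n a b) (at level 40, left associativity).

Definition weight (j : nat) : K := ((j + 1) * (j + 2))%:R^-1.
Local Notation w := weight.

Definition coef (x : V) (m : nat) : K := x 0 (inord m).

Lemma coefD x y m : coef (x + y) m = coef x m + coef y m.
Proof. by rewrite /coef mxE. Qed.

Lemma coefZ c x m : coef (c *: x) m = c * coef x m.
Proof. by rewrite /coef mxE. Qed.

Lemma coef0 m : coef 0 m = 0.
Proof. by rewrite /coef mxE. Qed.

Lemma coef_e k m : (k <= n)%N -> (m <= n)%N -> coef (e k) m = (m == k)%:R.
Proof. by move=> kn mn; rewrite /coef mxE eqxx -val_eqE /= !inordK. Qed.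

Lemma coef_inj x y : (forall m, (m <= n)%N -> coef x m = coef y m) -> x = y.
Proof.
move=> xy; apply/rowP => i; have := xy i (ltn_ord i).
by rewrite /coef inord_val.
Qed.

Lemma row_sum_e (x : V) : x = \sum_(i < n.+1) coef x i *: e i.
Proof.
rewrite [LHS]row_sum_delta; apply: eq_bigr => i _.
by rewrite /coef /Defs.e !inord_val.
Qed.

(** The [clone]s present scaling as a canonical scaling law, the form in which
    [bilinear_for] takes its two scaling operators. *)
Lemma idd_mul_bilinear : bilinear_for
  (GRing.Scale.Law.clone _ _ *:%R _) (GRing.Scale.Law.clone _ _ *:%R _)
  (idd_mul K n).
Proof.
split=> [b|a] c x y /=; rewrite /idd_mul scaler_sumr -big_split /=;
  apply: eq_bigr => i _; rewrite scaler_sumr -big_split /=;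
  apply: eq_bigr => j _; rewrite !mxE scalerA -scalerDl; congr (_ *: _); ring.
Qed.

HB.instance Definition _ := bilinear_isBilinear.Build K V V V _ _
  (idd_mul K n) idd_mul_bilinear.

Lemma is_derivation_basis (D : 'End(V)) :
  (forall i j, (i <= n)%N -> (j <= n)%N ->
     D (e i <o> e j) = D (e i) <o> e j + e i <o> D (e j)) ->
  is_derivation (idd_mul K n) D.
Proof.
move=> De a b; rewrite [a]row_sum_e [b]row_sum_e.
rewrite linear_sumlz linear_sum [D (\sum_(i < n.+1) coef a i *: e i)]linear_sum.
rewrite [X in _ = X + _]linear_sumlz [X in _ = _ + X]linear_sumlz -big_split /=.
apply: eq_bigr => i _; rewrite [D (\sum_(j < n.+1) coef b j *: e j)]linear_sum.
rewrite [X in D X = _]linear_sumr [LHS]linear_sum.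
rewrite [X in _ = X + _]linear_sumr [X in _ = _ + X]linear_sumr -big_split /=.
apply: eq_bigr => j _.
rewrite !(linearZl_LR, linearZr_LR, linearZ_LR) /= De ?leq_ord // !scalerDr.
by congr (_ + _); rewrite !scalerA mulrC.
Qed.

Lemma coef_basis_mul i j m : (m <= n)%N ->
  coef (idd_basis_mul K n i j) m = if m == (i + j + 2)%N then w j else 0.
Proof.
move=> mn; rewrite /idd_basis_mul; case: ifP => ijn.
  by rewrite coefZ coef_e //; case: eqP => _; rewrite ?mulr1 ?mulr0.
by rewrite coef0; case: eqP => // mE; lia.
Qed.

Lemma coef_mull i x m : (i <= n)%N -> (m <= n)%N ->
  coef (e i <o> x) m =
  if (i + 2 <= m)%N then coef x (m - i - 2) * w (m - i - 2) else 0.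
Proof.
move=> iln mn; pose j := (m - i - 2)%N.
rewrite [in LHS](row_sum_e x) linear_sumr /coef summxE.
transitivity (\sum_(k < n.+1) coef x k * coef (idd_basis_mul K n i k) m).
  apply: eq_bigr => k _.
  by rewrite linearZr_LR /= idd_mul_basis // ?mxE ?leq_ord.
case: ifP => im; last first.
  apply: big1 => k _; rewrite coef_basis_mul //.
  by case: eqP => [?|]; [lia | rewrite mulr0].
have jn : (j < n.+1)%N by rewrite /j; lia.
rewrite (bigD1 (Ordinal jn)) //= coef_basis_mul // ifT; last by rewrite /j; lia.
rewrite big1 ?addr0 // => k /eqP kj; rewrite coef_basis_mul //.
case: eqP => [mE|]; last by rewrite mulr0.
by case: kj; apply: val_inj => /=; rewrite /j; lia.
Qed.

Lemma coef_mulr j x m : (j <= n)%N -> (m <= n)%N ->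
  coef (x <o> e j) m = if (j + 2 <= m)%N then coef x (m - j - 2) * w j else 0.
Proof.
move=> jln mn; pose i := (m - j - 2)%N.
rewrite [in LHS](row_sum_e x) linear_sumlz /coef summxE.
transitivity (\sum_(k < n.+1) coef x k * coef (idd_basis_mul K n k j) m).
  apply: eq_bigr => k _.
  by rewrite linearZl_LR /= idd_mul_basis // ?mxE ?leq_ord.
case: ifP => jm; last first.
  apply: big1 => k _; rewrite coef_basis_mul //.
  by case: eqP => [?|]; [lia | rewrite mulr0].
have i_n : (i < n.+1)%N by rewrite /i; lia.
rewrite (bigD1 (Ordinal i_n)) //= coef_basis_mul // ifT; last by rewrite /i; lia.
rewrite big1 ?addr0 // => k /eqP ki; rewrite coef_basis_mul //.
case: eqP => [mE|]; last by rewrite mulr0.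
by case: ki; apply: val_inj => /=; rewrite /i; lia.
Qed.

Lemma derivation_coef (D : 'End(V)) i j m :
  is_derivation (idd_mul K n) D -> (i + j + 2 <= n)%N -> (m <= n)%N ->
  w j * coef (D (e (i + j + 2))) m =
    (if (j + 2 <= m)%N then coef (D (e i)) (m - j - 2) * w j else 0) +
    (if (i + 2 <= m)%N then coef (D (e j)) (m - i - 2) * w (m - i - 2) else 0).
Proof.
move=> dD ijn mn.
have [iln jln] : (i <= n)%N /\ (j <= n)%N by lia.
rewrite -coef_mull // -coef_mulr // -coefD -dD idd_mul_basis //.
by rewrite /idd_basis_mul ijn linearZ_LR coefZ.
Qed.

(** A degree-[k] map has [e_i e_j] and both Leibniz terms all in degree
    [i + j + 2 + k], so one scalar equation per pair [(i, j)] suffices, and the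
    pairs for which that degree exceeds [n] are automatic.  The second
    hypothesis excludes values [e_(i+k)] beyond [n], where [e] is only a
    default value. *)
Lemma homogeneous_derivation (f : nat -> V) (c : nat -> K) (k : nat) :
  (forall i, (i <= n)%N -> f i = c i *: e (i + k)) ->
  (forall i, (i <= n)%N -> (n < i + k)%N -> c i = 0) ->
  (forall i j, (i + j + 2 + k <= n)%N ->
     w j * c (i + j + 2) = c i * w j + c j * w (j + k)) ->
  is_derivation (idd_mul K n) (lin_ext f).
Proof.
move=> fE c0 cE; apply: is_derivation_basis => i j iln jln.
rewrite !lin_ext_basis // !fE // linearZl_LR linearZr_LR /=.
have -> : c i *: (e (i + k) <o> e j) = c i *: idd_basis_mul K n (i + k) j.
  have [ikn|nik] := leqP (i + k) n; first by rewrite idd_mul_basis.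
  by rewrite c0 // !scale0r.
have -> : c j *: (e i <o> e (j + k)) = c j *: idd_basis_mul K n i (j + k).
  have [jkn|njk] := leqP (j + k) n; first by rewrite idd_mul_basis.
  by rewrite c0 // !scale0r.
rewrite idd_mul_basis // /idd_basis_mul -/(w j) -/(w (j + k)).
have -> : (i + k + j + 2 = i + j + 2 + k)%N by lia.
have -> : (i + (j + k) + 2 = i + j + 2 + k)%N by lia.
case: (leqP (i + j + 2 + k) n) => [ijkn|nijk].
  rewrite ifT; last by lia.
  rewrite linearZ_LR /= lin_ext_basis ?fE; [|lia..].
  by rewrite !scalerA cE // scalerDl.
rewrite !scaler0 addr0; case: ifP => ijn; last by rewrite linear0.
by rewrite linearZ_LR /= lin_ext_basis // fE // c0 // scale0r scaler0.
Qed.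

End Algebra.

(** * Constraints on a derivation *)

Section CharacteristicZero.
Variables (K : numFieldType) (n : nat).
Local Notation V := 'rV[K]_n.+1.
Local Notation e := (e K n).
Local Notation w := (weight K).
Local Notation is_der := (is_derivation (idd_mul K n)).
Local Notation coef := (coef K n).

Lemma weight_neq0 j : w j != 0.
Proof. by rewrite invr_eq0 pnatr_eq0; lia. Qed.

(** The kernel of a derivation is a subalgebra, and [e_0], [e_1] generate:
    right multiplication by [e_0] sends [e_k] to a nonzero multiple of
    [e_(k+2)]. *)
Lemma derivation_eq0 (D : 'End(V)) :
  is_der D -> D (e 0) = 0 -> D (e 1) = 0 -> D = 0.
Proof.
move=> dD D0 D1.
have De k : (k <= n)%N -> D (e k) = 0.
  elim/ltn_ind: k => -[|[|k]] // IHk kn.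
  apply: (scalerI (weight_neq0 0)); rewrite scaler0 -linearZ_LR /=.
  have <- : idd_mul K n (e k) (e 0) = w 0 *: e k.+2.
    by rewrite idd_mul_basis /idd_basis_mul ?addn0 ?addn2 ?kn //; lia.
  by rewrite dD D0 (IHk k) ?linear0l ?linear0r ?addr0 //; lia.
apply/lfunP => x; rewrite (row_sum_e K n x) linear_sum zero_lfunE.
rewrite big1 // => i _.
by rewrite linearZ_LR /= De ?scaler0 ?leq_ord.
Qed.

Lemma weight0 : w 0 = 2^-1. Proof. by []. Qed.

Lemma weight1 : w 1 = 6^-1. Proof. by []. Qed.

Lemma weightE j : w j = ((j%:R + 1) * (j%:R + 2))^-1.
Proof. by rewrite /weight natrM !natrD. Qed.

(** [3 (e_0 e_1) = e_1 e_0]; in degree 2 only the terms coming from [b_0] are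
    present, with different weights on the two sides. *)
Lemma derivation_e1_coef0 (D : 'End(V)) :
  is_der D -> (3 <= n)%N -> coef (D (e 1)) 0 = 0.
Proof.
move=> dD n3.
have := derivation_coef K n D 0 1 2 dD n3 (ltnW n3).
have := derivation_coef K n D 1 0 2 dD n3 (ltnW n3).
rewrite /= weight0 weight1 !addr0 !add0r; set c := coef _ 2; set b := coef _ _.
move=> H10 H01.
(* Eliminating [c], the degree-2 coefficient of [D e_3], leaves [b = 0]. *)
have -> : b = (2^-1 * c - b / 2) - 3 * (6^-1 * c - b / 2) by field.
by rewrite H10 H01 !subrr mulr0 subr0.
Qed.

(** Comparison of the derivatives of [6 (e_0 e_1)] and [2 (e_1 e_0)], both equal
    to [e_3], in degree [k + 3]. *)
Lemma derivation_relation_e3 (D : 'End(V)) k :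
  is_der D -> (k + 3 <= n)%N ->
  coef (D (e 0)) k * (1 - 2 * w k) = coef (D (e 1)) k.+1 * (1 - 6 * w k.+1).
Proof.
move=> dD kn; have n3 : (3 <= n)%N by lia.
have := derivation_coef K n D 0 1 (k + 3) dD n3 kn.
have := derivation_coef K n D 1 0 (k + 3) dD n3 kn.
rewrite !ifT; try lia.
rewrite weight0 weight1.
have -> : (k + 3 - 0 - 2 = k.+1)%N by lia.
have -> : (k + 3 - 1 - 2 = k)%N by lia.
rewrite (_ : 1 + 0 + 2 = 0 + 1 + 2)%N //.
set c := coef (D (e (0 + 1 + 2))) _; set a := coef _ k; set b := coef _ k.+1.
move=> H10 H01.
(* The multipliers 2 and 6 invert the weights of [e_1 e_0] and [e_0 e_1], so
   that [c] cancels. *)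
have : a * (1 - 2 * w k) - b * (1 - 6 * w k.+1) =
  2 * (2^-1 * c - (b / 2 + a * w k))
  - 6 * (6^-1 * c - (a / 6 + b * w k.+1)) by field.
by rewrite H10 H01 !subrr !mulr0 subr0 => /subr0_eq.
Qed.

(** Comparison of the derivatives of [6 (e_1 e_1)] and [2 (e_2 e_0)], both equal
    to [e_4], in degree [k + 4]; [D e_2] is eliminated through
    [e_2 = 2 (e_0 e_0)]. *)
Lemma derivation_relation_e4 (D : 'End(V)) k :
  is_der D -> (k + 4 <= n)%N ->
  coef (D (e 0)) k * (1 + 4 * w k) = coef (D (e 1)) k.+1 * (1 + 6 * w k.+1).
Proof.
move=> dD kn; have [n2 n4] : (2 <= n /\ 4 <= n)%N by lia.
have := derivation_coef K n D 0 0 (k + 2) dD n2 ltac:(lia).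
have := derivation_coef K n D 2 0 (k + 4) dD n4 kn.
have := derivation_coef K n D 1 1 (k + 4) dD n4 kn.
rewrite !ifT; try lia.
rewrite weight0 weight1.
have -> : (k + 4 - 0 - 2 = k + 2)%N by lia.
have -> : (k + 4 - 1 - 2 = k.+1)%N by lia.
have -> : (k + 4 - 2 - 2 = k)%N by lia.
have -> : (k + 2 - 0 - 2 = k)%N by lia.
rewrite -!/(e 4) -/(e 2).
set c := coef (D (e 4)) _; set d := coef (D (e 2)) _.
set a := coef _ k; set b := coef _ k.+1 => H11 H20 H00.
(* The multipliers 6 and 2 cancel [c], and the last one then cancels [d]. *)
have : a * (1 + 4 * w k) - b * (1 + 6 * w k.+1) =
  6 * (6^-1 * c - (b / 6 + b * w k.+1)) - 2 * (2^-1 * c - (d / 2 + a * w k))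
  - 2 * (2^-1 * d - (a / 2 + a * w k)) by field.
by rewrite H11 H20 H00 !subrr !mulr0 !subr0 => /subr0_eq.
Qed.

(** The factor of [b_(k+1)] in [derivation_relation_e3] is
    [k (k + 5) / ((k + 2) (k + 3))], invertible exactly when [k] is nonzero. *)
Lemma derivation_e1_coefS (D : 'End(V)) k :
  is_der D -> (0 < k)%N -> (k + 3 <= n)%N ->
  coef (D (e 1)) k.+1 =
  coef (D (e 0)) k * (k%:R + 3) ^+ 2 / ((k%:R + 1) * (k%:R + 5)).
Proof.
move=> dD k0 kn; have := derivation_relation_e3 D k dD kn.
rewrite !weightE -[k.+1]addn1 natrD.
set a := coef _ k; set b := coef _ (k + 1) => H.
have -> : b = b * (1 - 6 * ((k%:R + 1 + 1) * (k%:R + 1 + 2))^-1)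
            * ((k%:R + 2) * (k%:R + 3)) / (k%:R * (k%:R + 5)).
  field.
  by rewrite ?natr1 -?natrD !pnatr_eq0; lia.
rewrite -H; field.
by rewrite ?natr1 -?natrD !pnatr_eq0; lia.
Qed.

(** Substituting [b_(k+1)] in [derivation_relation_e4] leaves
    [6 a_k / ((k + 2) (k + 5)) = 0]. *)
Lemma derivation_e0_coef_middle (D : 'End(V)) k :
  is_der D -> (0 < k)%N -> (k + 4 <= n)%N -> coef (D (e 0)) k = 0.
Proof.
move=> dD k0 kn; have := derivation_relation_e4 D k dD kn.
rewrite derivation_e1_coefS //; last by lia.
rewrite !weightE -[k.+1]addn1 natrD; set a := coef _ k => H.
have -> : a = (k%:R + 2) * (k%:R + 5) / 6 *
  (a * (k%:R + 3) ^+ 2 / ((k%:R + 1) * (k%:R + 5)) *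
     (1 + 6 * ((k%:R + 1 + 1) * (k%:R + 1 + 2))^-1)
   - a * (1 + 4 * ((k%:R + 1) * (k%:R + 2))^-1)).
  field.
  by rewrite ?natr1 -?natrD !pnatr_eq0; lia.
by rewrite -H subrr mulr0.
Qed.

Lemma derivation_e1_coef1 (D : 'End(V)) :
  is_der D -> (4 <= n)%N -> coef (D (e 1)) 1 = coef (D (e 0)) 0 * 3 / 2.
Proof.
move=> dD n4; have := derivation_relation_e4 D 0 dD n4.
rewrite weight0 weight1; set a := coef _ 0; set b := coef _ 1 => H.
have -> : b = b * (1 + 6 / 6) / 2 by field.
by rewrite -H; field.
Qed.

(** * The listed maps are derivations *)

Lemma derivation_varphi : is_der (varphi K n).
Proof.
apply: (homogeneous_derivation K n _ (fun i => i%:R + 2) 0) => [i _|i|i j _].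
- by rewrite addn0.
- by rewrite addn0 ltnNge => ->.
- by rewrite addn0 !natrD; ring.
Qed.

Lemma derivation_phi0 : is_der (phi0 K n).
Proof.
apply: (homogeneous_derivation K n _ (fun i => (i == 0)%:R) n) =>
  [[|i]|[|i]|i j] *.
- by rewrite scale1r.
- by rewrite scale0r.
- by lia.
- by [].
- by lia.
Qed.

Hypothesis n4 : (4 <= n)%N.

Lemma derivation_phi1 : is_der (phi1 K n).
Proof.
apply: (homogeneous_derivation K n _ (fun i => (i == 0)%:R) (n - 1)) =>
  [[|i]|[|i]|i j] *.
- by rewrite scale1r.
- by rewrite scale0r.
- by lia.
- by [].
- by lia.
Qed.

Lemma derivation_psi0 : is_der (psi0 K n).
Proof.
apply: (homogeneous_derivation K n _ (fun i => (i == 1)%:R) (n - 1)) =>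
  [[|[|i]]|[|[|i]]|i j] *.
- by rewrite scale0r.
- by rewrite scale1r; congr (e _); lia.
- by rewrite scale0r.
- by [].
- by lia.
- by [].
- by lia.
Qed.

Lemma derivation_psi1 : is_der (psi1 K n).
Proof.
apply: (homogeneous_derivation K n _ (fun i => (i == 1)%:R) (n - 2)) =>
  [[|[|i]]|[|[|i]]|i j] *.
- by rewrite scale0r.
- by rewrite scale1r; congr (e _); lia.
- by rewrite scale0r.
- by [].
- by lia.
- by [].
- have [-> ->] : (i = 0 /\ j = 0)%N by lia.
  by rewrite /= !(mulr0, mul0r) addr0.
Qed.

Lemma derivation_phi2 : is_der (phi2 K n).
Proof.
pose c i : K := match i with
  | 0 => n%:R * (n%:R - 1)
  | 2 => n%:R ^+ 2 - n%:R + 2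
  | _ => 0 end.
apply: (homogeneous_derivation K n _ c (n - 2)) =>
  [[|[|[|i]]]|[|[|[|i]]]|i j] * //=; rewrite ?scale0r //; try lia.
- by congr (_ *: e _); lia.
- have [-> ->] : (i = 0 /\ j = 0)%N by lia.
  have nE : n = (n - 2 + 2)%N by lia.
  rewrite /c /= !weightE add0n; set p := (n - 2)%N in nE *.
  rewrite nE natrD; field.
  by rewrite ?natr1 -?natrD !pnatr_eq0; lia.
Qed.

Lemma derivation_phi3 : is_der (phi3 K n).
Proof.
pose c i : K := match i with
  | 0 => (n%:R - 1) * (n%:R ^+ 2 - 4)
  | 1 => n%:R ^+ 2 * (n%:R - 1)
  | 2 => (n%:R + 2) * (n%:R ^+ 2 - 3 * n%:R + 4)
  | 3 => (n%:R + 1) * (n%:R ^+ 2 - 2 * n%:R + 4)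
  | _ => 0 end.
apply: (homogeneous_derivation K n _ c (n - 3)) =>
  [[|[|[|[|i]]]]|[|[|[|[|i]]]]|i j] * //=; rewrite ?scale0r //; try lia.
- by congr (_ *: e _); lia.
- by congr (_ *: e _); lia.
- by congr (_ *: e _); lia.
- have nE : n = (n - 3 + 3)%N by lia.
  have ij : ((i == 0) && (j == 0) || (i == 0) && (j == 1) ||
             (i == 1) && (j == 0))%N by lia.
  case/orP: ij => [/orP[]|] /andP[/eqP-> /eqP->];
  rewrite /c /= !weightE ?natrD; set p := (n - 3)%N in nE *;
  rewrite nE natrD; field; by rewrite ?(nat1r, natr1) -?natrD !pnatr_eq0; lia.
Qed.

Definition listed_derivations : seq 'End(V) :=
  [:: varphi K n; phi0 K n; phi1 K n; phi2 K n; phi3 K n; psi0 K n; psi1 K n].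

Lemma listed_derivationP E : E \in listed_derivations -> is_der E.
Proof.
rewrite !inE; do 6?[case/orP]; move/eqP => ->.
- exact: derivation_varphi.
- exact: derivation_phi0.
- exact: derivation_phi1.
- exact: derivation_phi2.
- exact: derivation_phi3.
- exact: derivation_psi0.
- exact: derivation_psi1.
Qed.

(** * Every derivation is a combination of the listed maps *)

(** Evaluates the Kronecker deltas between basis indices that linear arithmetic
    can decide from the context. *)
Ltac eval_coef := repeat match goal with
  | |- context [nat_of_bool (@eq_op _ ?a ?b)] =>
    first [ rewrite (_ : (a == b) = true); last by lia
          | rewrite (_ : (a == b) = false); last by lia ]
  end; rewrite ?mulr1n ?mulr0n.

Lemma derivation_in_span (D : 'End(V)) :
  is_der D -> D \in <<listed_derivations>>%VS.
Proof.
move=> dD; pose a := coef (D (e 0)); pose b := coef (D (e 1)).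
(* [phi2 e_0] is [g2] times [e_(n-2)] and [phi3 e_0] is [g3] times [e_(n-3)];
   dividing by them makes the parameters match coefficients of [D e_0]. *)
pose g2 : K := n%:R * (n%:R - 1); pose g3 : K := (n%:R - 1) * (n%:R ^+ 2 - 4).
pose E : 'End(V) :=
  (a 0 / 2) *: varphi K n + a n *: phi0 K n + a (n - 1)%N *: phi1 K n +
  (a (n - 2)%N / g2) *: phi2 K n + (a (n - 3)%N / g3) *: phi3 K n +
  b n *: psi0 K n + b (n - 1)%N *: psi1 K n.
have E_span : E \in <<listed_derivations>>%VS.
  by rewrite !rpredD // rpredZ // memv_span // !inE eqxx ?orbT.
have nR : n%:R = (n - 4)%:R + 4 :> K by rewrite -natrD subnK.
have g2_neq0 : g2 != 0.
  have -> : g2 = ((n - 4)%:R + 4) * ((n - 4)%:R + 3) by rewrite /g2 nR; ring.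
  by rewrite mulf_neq0 // -natrD pnatr_eq0; lia.
have g3E : g3 = ((n - 4)%:R + 3) * (((n - 4)%:R + 2) * ((n - 4)%:R + 6)).
  by rewrite /g3 nR; ring.
have g3_neq0 : g3 != 0.
  by rewrite g3E !mulf_neq0 // -natrD pnatr_eq0; lia.
suff DE0 : -1 *: E + D = 0.
  by rewrite scaleN1r addrC in DE0; rewrite (subr0_eq DE0).
apply: derivation_eq0.
- apply: derivation_linear => //; apply: derivation_span E_span.
  exact: listed_derivationP.
- rewrite /E !(add_lfunE, scale_lfunE).
  rewrite /varphi /phi0 /phi1 /phi2 /phi3 /psi0 /psi1.
  rewrite !lin_ext_basis // -/g2 -/g3.
  apply: coef_inj => m mn; rewrite !(coefD, coefZ, coef0) !coef_e //; try lia.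
  rewrite -/(a m).
  have : m = 0%N \/ m = (n - 3)%N \/ m = (n - 2)%N \/ m = (n - 1)%N \/ m = n \/
    (0 < m)%N /\ (m + 4 <= n)%N by lia.
  (case=> [->|[->|[->|[->|[->|[m0 m4]]]]]];
     last (by rewrite /a (derivation_e0_coef_middle D m) //; eval_coef; ring));
  by eval_coef; field; rewrite ?g2_neq0 ?g3_neq0.
- rewrite /E !(add_lfunE, scale_lfunE).
  rewrite /varphi /phi0 /phi1 /phi2 /phi3 /psi0 /psi1.
  rewrite !lin_ext_basis //; try lia.
  apply: coef_inj => m mn; rewrite !(coefD, coefZ, coef0) !coef_e //; try lia.
  rewrite -/(b m).
  have : m = 0%N \/ m = 1%N \/ m = (n - 3).+1 \/ m = (n - 1)%N \/ m = n \/
    exists k, [/\ m = k.+1, (0 < k)%N & (k + 4 <= n)%N].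
    have [|[|]] : (m <= 1)%N \/ (n <= m + 2)%N \/ (1 < m)%N /\ (m + 3 <= n)%N.
    - by lia.
    - by lia.
    - by lia.
    by move=> *; do 5!right; exists m.-1; split; lia.
  case=> [->|[->|[->|[->|[->|[k [-> k0 k4]]]]]]].
  + by rewrite /b derivation_e1_coef0 //; [eval_coef; ring | lia].
  + rewrite /b derivation_e1_coef1 // -/(a 0); eval_coef.
    by field; rewrite ?g2_neq0 ?g3_neq0.
  + rewrite /b [coef _ (n - 3).+1]derivation_e1_coefS //; [|lia|lia].
    rewrite -/(a (n - 3)%N); eval_coef.
    (* In terms of [n - 4] every denominator is a sum of nonnegative terms. *)
    have -> : (n - 3)%:R = (n - 4)%:R + 1 :> K.
      by rewrite natr1; congr _%:R; lia.
    rewrite g3E nR; field.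
    by rewrite g2_neq0 ?natr1 -?natrD !pnatr_eq0; lia.
  + by eval_coef; field; rewrite ?g2_neq0 ?g3_neq0.
  + by eval_coef; field; rewrite ?g2_neq0 ?g3_neq0.
  + rewrite /b [coef _ k.+1]derivation_e1_coefS //; last by lia.
    rewrite derivation_e0_coef_middle //; eval_coef.
    by rewrite !mul0r; field; rewrite ?g2_neq0 ?g3_neq0.
Qed.

Lemma derivations_span (D : 'End(V)) :
  is_der D <-> D \in <<listed_derivations>>%VS.
Proof.
split; first exact: derivation_in_span.
by apply: derivation_span; exact: listed_derivationP.
Qed.

End CharacteristicZero.

(** * Complex coefficients *)

Theorem theorem4p29 (R : realType) (n : nat) (hn : (4 <= n)%N)
    (D : 'End('rV[complex R]_n.+1)) :
  is_derivation (idd_mul (complex R) n) D <->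
  D \in <<[:: varphi (complex R) n;
              phi0 (complex R) n; phi1 (complex R) n;
              phi2 (complex R) n; phi3 (complex R) n;
              psi0 (complex R) n; psi1 (complex R) n]>>%VS.
Proof. exact: (derivations_span (complex R) n hn D). Qed.
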